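(* A regular curve $\gamma(t)=(u(t),v(t))$ in $\mathbb{H}^2(+)$ is a horo-catenary (with parameter $\lambda\in\mathbb{R}$) if and only if its curvature $\kappa_h$ satisfies $$\kappa_h=\frac{u'}{(d_b+\lambda)\sqrt m},$$ where $m=u'^2+v'^2$ and $d_b=\log v$.
   Context: $\mathbb{H}^2$ is the upper half-plane $\{(x,y)\in\mathbb{R}^2:y>0\}$ with the metric $g=\frac{dx^2+dy^2}{y^2}$, and $\mathbb{H}^2(+)=\{(x,y)\in\mathbb{H}^2:y>1\}$. On $\mathbb{H}^2(+)$ the hyperbolic distance from $(x,y)$ to the horocycle $\mathcal{H}=\{(t,1):t\in\mathbb{R}\}$ is $d_b=\log y$. Regular means $\gamma'(t)\neq0$ for all $t$. The potential energy of $\gamma=(u,v)$, $t\in[a,b]$, is $$\mathcal{E}_{hor}[\gamma]=\int_a^b(\log v+\lambda)\frac{\sqrt{u'^2+v'^2}}{v}\,dt,$$ where $\lambda\in\mathbb{R}$ is a constant (a Lagrange multiplier). A horo-catenary is a critical point of $\mathcal{E}_{hor}$ (for variations with fixed endpoints), i.e. $(u,v)$ satisfies both Euler–Lagrange equations of the integrand. Sign convention: $\kappa_h$ is the geodesic curvature of $\gamma$ in $\mathbb{H}^2$ with respect to the unit normal $\mathbf{n}=v\frac{(-v',u')}{\sqrt m}$; explicitly $\kappa_h=v\,\frac{u'v''-u''v'}{m^{3/2}}+\frac{u'}{\sqrt m}$. *)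

(* Defs.v *)
From Stdlib Require Import Reals.
From Coquelicot Require Import Coquelicot.
Open Scope R_scope.

(** A C^2 function on the closed interval [a,b] is represented by a total
    function whose first two derivatives exist in a neighbourhood of [a,b], the
    second being continuous at the points of [a,b]: [Derive] is two-sided, so
    the neighbourhood is what gives the derivatives at [a] and [b] their
    meaning. *)
Definition C2_on (a b : R) (f : R -> R) : Prop :=
  forall t, a <= t <= b ->
    locally t (fun s => ex_derive f s /\ ex_derive (Derive f) s) /\
    continuous (Derive (Derive f)) t.

(** Squared Euclidean speed [m = u'^2 + v'^2]. *)
Definition speed2 (u v : R -> R) (t : R) : R := Derive u t ^ 2 + Derive v t ^ 2.

Definition regular_on (a b : R) (u v : R -> R) : Prop :=
  forall t, a <= t <= b -> (Derive u t, Derive v t) <> (0, 0).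

Definition in_H2plus (a b : R) (u v : R -> R) : Prop :=
  forall t, a <= t <= b -> 1 < v t.

(** Hyperbolic distance from a point of height [y > 1] to the horocycle
    [y = 1]. *)
Definition dist_horocycle (y : R) : R := ln y.

(** Geodesic curvature in the metric [(dx^2 + dy^2) / y^2], with respect to the
    unit normal [v (-v', u') / sqrt m]. *)
Definition kappa_h (u v : R -> R) (t : R) : R :=
  let m := speed2 u v t in
  v t * ((Derive u t * Derive (Derive v) t - Derive (Derive u) t * Derive v t)
           / sqrt m ^ 3)
  + Derive u t / sqrt m.

Definition E_hor (lambda a b : R) (u v : R -> R) : R :=
  RInt (fun t => (dist_horocycle (v t) + lambda) * (sqrt (speed2 u v t) / v t))
       a b.

(** Critical points of [E_hor] for C^2 variations with fixed endpoints: the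
    derivative at [s = 0] of the energy of [(u + s xi, v + s eta)] exists and
    vanishes. For a regular C^2 curve in the half-plane [y > 1], the varied
    curves are again regular and contained in it as soon as [s] is small. *)
Definition horo_catenary (lambda a b : R) (u v : R -> R) : Prop :=
  forall xi eta : R -> R,
    C2_on a b xi -> C2_on a b eta ->
    xi a = 0 -> xi b = 0 -> eta a = 0 -> eta b = 0 ->
    is_derive
      (fun s => E_hor lambda a b (fun t => u t + s * xi t)
                                 (fun t => v t + s * eta t)) 0 0.

(* Main.v *)
(** Write [F = log v + lambda], [m = u'^2 + v'^2] and let [X = u' - F kappa_h sqrt m].
    Differentiating under the integral sign and integrating by parts, the first
    variation of the energy along [(xi, eta)] is the integral of
    [(u' eta - v' xi) X / (v^2 sqrt m)], so criticality means [X = 0] on [[a, b]].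
    This is the stated relation wherever [F <> 0]. In both directions one has
    [F X = 0] everywhere; the momentum [P = F u' / (v sqrt m)] satisfies
    [P' = v' X / (v^2 sqrt m)], hence [P^2] is constant. If [F] has a zero, then
    [P = 0], i.e. [F u' = 0]; differentiating, [u' v' = 0] and then
    [u'' v' + u' v'' = 0], which makes both relations hold at the zeros of [F]
    exactly when [u' = 0] there. *)

Require Import Defs.
From Stdlib Require Import Reals Lra.
From Coquelicot Require Import Coquelicot.
Open Scope R_scope.

(** * Functions on a closed interval *)

Lemma C2_on_is_derive (a b : R) (f : R -> R) (t : R) :
  C2_on a b f -> a <= t <= b -> is_derive f t (Derive f t).
Proof.
  intros hf ht; destruct (hf t ht) as [hl _].
  apply Derive_correct; exact (proj1 (locally_singleton _ _ hl)).
Qed.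

Lemma C2_on_is_derive2 (a b : R) (f : R -> R) (t : R) :
  C2_on a b f -> a <= t <= b -> is_derive (Derive f) t (Derive (Derive f) t).
Proof.
  intros hf ht; destruct (hf t ht) as [hl _].
  apply Derive_correct; exact (proj2 (locally_singleton _ _ hl)).
Qed.

Lemma is_derive_continuous (f : R -> R) (t l : R) :
  is_derive f t l -> continuous f t.
Proof.
  intros h; apply (ex_derive_continuous f t); exists l; exact h.
Qed.

Lemma C2_on_continuous (a b : R) (f : R -> R) (t : R) :
  C2_on a b f -> a <= t <= b ->
  continuous f t /\ continuous (Derive f) t /\ continuous (Derive (Derive f)) t.
Proof.
  intros hf ht; repeat split.
  - exact (is_derive_continuous _ _ _ (C2_on_is_derive _ _ _ _ hf ht)).
  - exact (is_derive_continuous _ _ _ (C2_on_is_derive2 _ _ _ _ hf ht)).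
  - exact (proj2 (hf t ht)).
Qed.

Lemma C2_on_const (a b c : R) : C2_on a b (fun _ => c).
Proof.
  assert (h0 : forall t, Derive (fun _ : R => c) t = 0)
    by (intros t; apply Derive_const).
  assert (h1 : forall t, Derive (Derive (fun _ : R => c)) t = 0).
  { intros t; rewrite (Derive_ext _ _ t h0); apply Derive_const. }
  intros t _; split.
  - apply filter_forall; intros s; split.
    + apply ex_derive_const.
    + apply (ex_derive_ext (fun _ : R => 0)).
      * intros r; symmetry; apply h0.
      * apply ex_derive_const.
  - apply (continuous_ext (fun _ : R => 0)).
    + intros r; symmetry; apply h1.
    + apply continuous_const.
Qed.

(** At an endpoint nothing is known about [f] on one side, but the difference quotients taken from
    inside the interval are all zero, and a two-sided derivative is already determined by them. *)
Lemma is_derive_zero_of_zero_on (a b : R) (f : R -> R) (t l : R) :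
  a < b -> (forall s, a <= s <= b -> f s = 0) ->
  a <= t <= b -> is_derive f t l -> l = 0.
Proof.
  intros hab hf ht hd.
  apply is_derive_Reals in hd.
  destruct (Req_dec l 0) as [h0 | h0]; [exact h0 | exfalso].
  destruct (hd (Rabs l) (Rabs_pos_lt _ h0)) as [[d hd0] hd1]; simpl in hd1.
  (* The increment points towards the farther endpoint and is at most half the length of the
     interval, so [t + h] stays in [[a, b]]. *)
  assert (hh : exists h, h <> 0 /\ Rabs h < d /\ a <= t + h <= b).
  { assert (hm := Rmin_l (d / 2) ((b - a) / 2)).
    assert (hm' := Rmin_r (d / 2) ((b - a) / 2)).
    assert (hm0 : 0 < Rmin (d / 2) ((b - a) / 2)) by (apply Rmin_glb_lt; lra).
    set (k := Rmin (d / 2) ((b - a) / 2)) in *.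
    destruct (Rle_dec t ((a + b) / 2)) as [hc | hc].
    - exists k; rewrite Rabs_pos_eq by lra; repeat split; lra.
    - exists (- k); rewrite Rabs_Ropp, Rabs_pos_eq by lra; repeat split; lra. }
  destruct hh as [h [hne [hlt hin]]].
  specialize (hd1 h hne hlt).
  rewrite (hf _ hin), (hf _ ht) in hd1.
  replace ((0 - 0) / h - l) with (- l) in hd1 by (field; exact hne).
  rewrite Rabs_Ropp in hd1; lra.
Qed.

Lemma const_of_is_derive_zero_on (a b : R) (f : R -> R) :
  (forall t, a <= t <= b -> is_derive f t 0) ->
  forall t, a <= t <= b -> f t = f a.
Proof.
  intros hf t ht.
  destruct (Rle_lt_or_eq_dec a t (proj1 ht)) as [hlt | heq]; [| subst; reflexivity].
  symmetry; apply (eq_is_derive f a t); [| exact hlt].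
  intros s hs; apply hf; lra.
Qed.

(** The integrals over [[a, s]] and [[s, b]] are nonnegative with sum zero, so the primitive of [f]
    from [a] vanishes on [[a, b]], and so does its derivative [f]. *)
Lemma continuous_nonneg_RInt_zero (a b : R) (f : R -> R) :
  a < b -> (forall t, continuous f t) -> (forall t, 0 <= f t) ->
  RInt f a b = 0 -> forall t, a <= t <= b -> f t = 0.
Proof.
  intros hab hc hpos hint t ht.
  assert (hex : forall c d, ex_RInt f c d)
    by (intros c d; apply (ex_RInt_continuous f); intros; apply hc).
  apply (is_derive_zero_of_zero_on a b (fun s => RInt f a s) t _ hab).
  - intros s hs.
    assert (h1 : 0 <= RInt f a s) by (apply RInt_ge_0; auto; lra).
    assert (h2 : 0 <= RInt f s b) by (apply RInt_ge_0; auto; lra).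
    assert (h3 := RInt_Chasles f a s b (hex _ _) (hex _ _)).
    unfold plus in h3; simpl in h3; lra.
  - exact ht.
  - apply (is_derive_RInt f (fun s => RInt f a s) a); [| apply hc].
    apply filter_forall; intros s; apply (RInt_correct f); apply hex.
Qed.

(* The test function [xi] solves [xi'' = g] with [xi a = xi b = 0], so that
   [0 = int (g xi) = - int xi'^2] forces [xi' = 0]. *)
Lemma fundamental_lemma_C2 (a b : R) (g : R -> R) :
  a < b -> (forall t, a <= t <= b -> continuous g t) ->
  (forall xi, C2_on a b xi -> xi a = 0 -> xi b = 0 ->
     RInt (fun t => g t * xi t) a b = 0) ->
  forall t, a <= t <= b -> g t = 0.
Proof.
  intros hab hg htest.
  (* [C2_on] speaks of neighbourhoods of the endpoints, so [xi] is built from an extension [e] of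
     [g] that is continuous on the whole line. *)
  destruct (C0_extension_le g a b hg) as [e [he heg]].
  assert (hprim : forall f : R -> R, (forall t, continuous f t) ->
            exists F : R -> R, F a = 0 /\ forall t, is_derive F t (f t)).
  { intros f hf; exists (fun s => RInt f a s).
    split; [apply (RInt_point a f) | intros t].
    apply (is_derive_RInt f (fun s => RInt f a s) a); [| apply hf].
    apply filter_forall; intros s; apply (RInt_correct f).
    apply (ex_RInt_continuous f); intros; apply hf. }
  destruct (hprim e he) as [G1 [_ hG1]].
  assert (cG1 : forall t, continuous G1 t)
    by (intros t; apply (is_derive_continuous _ _ _ (hG1 t))).
  destruct (hprim G1 cG1) as [G2 [hG2a hG2]].
  (* [G2] is a second primitive of [e] vanishing at [a]; subtracting the linear function of slope
     [k] makes it vanish at [b] without changing the second derivative. *)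
  set (k := G2 b / (b - a)).
  set (xi := fun t => G2 t - k * (t - a)).
  set (xi1 := fun t => G1 t - k).
  assert (hxi : forall t, is_derive xi t (xi1 t)).
  { intros t; unfold xi, xi1; auto_derive.
    - exists (G1 t); apply hG2.
    - replace (Derive (fun x => G2 x) t) with (G1 t) by (symmetry; apply is_derive_unique, hG2); ring. }
  assert (hxi1 : forall t, is_derive xi1 t (e t)).
  { intros t; unfold xi1; auto_derive.
    - exists (e t); apply hG1.
    - replace (Derive (fun x => G1 x) t) with (e t) by (symmetry; apply is_derive_unique, hG1); ring. }
  assert (D1 : forall t, Derive xi t = xi1 t)
    by (intros t; apply is_derive_unique, hxi).
  assert (D2 : forall t, Derive (Derive xi) t = e t).
  { intros t; rewrite (Derive_ext _ _ t D1); apply is_derive_unique, hxi1. }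
  assert (cxi : forall t, continuous xi t)
    by (intros t; apply (is_derive_continuous _ _ _ (hxi t))).
  assert (cxi1 : forall t, continuous xi1 t)
    by (intros t; apply (is_derive_continuous _ _ _ (hxi1 t))).
  assert (C2xi : C2_on a b xi).
  { intros t _; split.
    - apply filter_forall; intros s; split; [exists (xi1 s); apply hxi |].
      apply (ex_derive_ext xi1); [intros r; symmetry; apply D1 |].
      exists (e s); apply hxi1.
    - apply (continuous_ext e); [intros r; symmetry; apply D2 | apply he]. }
  assert (xia : xi a = 0) by (unfold xi; rewrite hG2a; ring).
  assert (xib : xi b = 0) by (unfold xi, k; field; lra).
  assert (I1 : RInt (fun t => e t * xi t) a b = 0).
  { rewrite <- (htest xi C2xi xia xib).
    apply RInt_ext; intros t; rewrite Rmin_left, Rmax_right by lra; intros ht.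
    rewrite heg by lra; reflexivity. }
  assert (c1 : forall t, continuous (fun t => e t * xi t) t)
    by (intros t; apply (continuous_mult e xi); [apply he | apply cxi]).
  assert (c2 : forall t, continuous (fun t => xi1 t * xi1 t) t)
    by (intros t; apply (continuous_mult xi1 xi1); apply cxi1).
  (* Integration by parts: the integrand is the derivative of [xi1 * xi], which is zero at both
     ends. *)
  assert (I2 : RInt (fun t => plus (e t * xi t) (xi1 t * xi1 t)) a b = 0).
  { apply is_RInt_unique.
    replace 0 with (minus (xi1 b * xi b) (xi1 a * xi a))
      by (rewrite xia, xib; unfold minus, plus, opp; simpl; ring).
    apply (is_RInt_derive (fun t => xi1 t * xi t)); intros t _.
    - apply (is_derive_mult xi1 xi t _ _ (hxi1 t) (hxi t)).
      intros; apply Rmult_comm.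
    - apply (continuous_plus (fun t => e t * xi t)); [apply c1 | apply c2]. }
  rewrite (RInt_plus (fun t => e t * xi t) (fun t => xi1 t * xi1 t)) in I2
    by (apply (ex_RInt_continuous (V := R_CompleteNormedModule)); auto).
  rewrite I1 in I2; unfold plus in I2; simpl in I2; rewrite Rplus_0_l in I2.
  intros t ht; rewrite <- heg by exact ht.
  apply (is_derive_zero_of_zero_on a b xi1 t _ hab); [| exact ht | apply hxi1].
  intros s hs.
  assert (hz := continuous_nonneg_RInt_zero a b _ hab c2
                  (fun t => Rle_0_sqr (xi1 t)) I2 s hs).
  simpl in hz; apply Rmult_integral in hz; tauto.
Qed.

(** * First variation of the energy *)

Lemma continuity_2d_pt_snd (f : R -> R) (s t : R) :
  continuous f t -> continuity_2d_pt (fun _ y => f y) s t.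
Proof.
  intros hf; apply (continuity_1d_2d_pt_comp f (fun _ y => y)).
  - apply continuity_pt_filterlim; exact hf.
  - apply continuity_2d_pt_id2.
Qed.

(** Together with its converse above, this lets the closure rules for two-variable continuity also
    prove continuity in one variable. *)
Lemma continuous_of_continuity_2d_pt_snd (f : R -> R) (t : R) :
  continuity_2d_pt (fun _ r => f r) 0 t -> continuous f t.
Proof.
  intros hf; apply continuity_pt_filterlim; intros eps heps.
  destruct (hf (mkposreal _ heps)) as [d hd].
  exists d; split; [apply cond_pos | intros r [_ hr]].
  apply (hd 0 r); [rewrite Rminus_diag, Rabs_R0; apply cond_pos | exact hr].
Qed.

Lemma continuity_2d_pt_locally_pos (g : R -> R -> R) (s t : R) :
  continuity_2d_pt g s t -> 0 < g s t -> locally_2d (fun x y => 0 < g x y) s t.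
Proof.
  intros hg hpos; destruct (hg (mkposreal _ hpos)) as [d hd].
  exists d; intros x y hx hy; specialize (hd x y hx hy); simpl in hd.
  apply Rabs_def2 in hd; lra.
Qed.

(** By compactness [g 0] has a positive minimum on [[a, b]], and uniform continuity keeps [g s t]
    within that minimum of [g 0 t] for all small [s] at once. *)
Lemma continuity_2d_pt_tube_pos (g : R -> R -> R) (a b : R) :
  a <= b ->
  (forall t, a <= t <= b -> continuity_2d_pt g 0 t) ->
  (forall t, a <= t <= b -> 0 < g 0 t) ->
  locally 0 (fun s => forall t, a <= t <= b -> 0 < g s t).
Proof.
  intros hab hg hpos.
  destruct (continuity_ab_min (g 0) a b hab) as [tm [hmin htm]].
  { intros c hc eps heps.
    destruct (hg c hc (mkposreal _ heps)) as [d hd].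
    exists d; split; [apply cond_pos | intros y [_ hy]].
    apply (hd 0 y); [rewrite Rminus_diag, Rabs_R0; apply cond_pos | exact hy]. }
  destruct (uniform_continuity_2d_1d' g a b 0 hg (mkposreal _ (hpos tm htm)))
    as [d hd].
  exists d; intros s hs t ht; simpl in hd.
  assert (hs' : Rabs (s - 0) < d) by exact hs.
  rewrite Rminus_0_r in hs'; apply Rabs_def2 in hs'.
  assert (hd0 := cond_pos d).
  assert (h : Rabs (g s t - g 0 t) < g 0 tm).
  { apply (hd t 0 t s); try lra; rewrite Rminus_diag, Rabs_R0; exact hd0. }
  apply Rabs_def2 in h; specialize (hmin t ht); lra.
Qed.

Definition energy_density (lambda y p q : R) : R :=
  (ln y + lambda) * (sqrt (p ^ 2 + q ^ 2) / y).

(** The total differential of the Lagrangian in height and velocity; the first coefficient comes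
    from the derivative of [(ln y + lambda) / y] in [y]. *)
Definition energy_density_diff (lambda y p q dy dp dq : R) : R :=
  (1 - (ln y + lambda)) / (y * y) * dy * sqrt (p ^ 2 + q ^ 2)
  + (ln y + lambda) / y * ((p * dp + q * dq) / sqrt (p ^ 2 + q ^ 2)).

(** Stated along an arbitrary path so that it serves twice: along the variation parameter for the
    first variation, and along the curve parameter for continuity of the integrand. *)
Lemma is_derive_energy_density (lambda : R) (y p q : R -> R)
    (t dy dp dq : R) :
  0 < y t -> 0 < p t ^ 2 + q t ^ 2 ->
  is_derive y t dy -> is_derive p t dp -> is_derive q t dq ->
  is_derive (fun r => energy_density lambda (y r) (p r) (q r)) t
    (energy_density_diff lambda (y t) (p t) (q t) dy dp dq).
Proof.
  intros hy hm dhy dhp dhq.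
  assert (hsq := sqrt_lt_R0 _ hm).
  unfold energy_density, energy_density_diff; auto_derive.
  - repeat split; try (eexists; eassumption); simpl in hm; lra.
  - replace (Derive (fun x => y x) t) with dy
      by (symmetry; apply is_derive_unique, dhy).
    replace (Derive (fun x => p x) t) with dp
      by (symmetry; apply is_derive_unique, dhp).
    replace (Derive (fun x => q x) t) with dq
      by (symmetry; apply is_derive_unique, dhq).
    replace (p t * (p t * 1) + q t * (q t * 1)) with (p t ^ 2 + q t ^ 2) by ring.
    field; lra.
Qed.

Lemma continuity_2d_pt_energy_density_diff (lambda : R)
    (y p q dy dp dq : R -> R -> R) (s t : R) :
  0 < y s t -> 0 < p s t ^ 2 + q s t ^ 2 ->
  continuity_2d_pt y s t -> continuity_2d_pt p s t -> continuity_2d_pt q s t ->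
  continuity_2d_pt dy s t -> continuity_2d_pt dp s t ->
  continuity_2d_pt dq s t ->
  continuity_2d_pt (fun s t => energy_density_diff lambda
    (y s t) (p s t) (q s t) (dy s t) (dp s t) (dq s t)) s t.
Proof.
  intros hy hm cy cp cq cdy cdp cdq.
  assert (hsq := sqrt_lt_R0 _ hm).
  assert (cm : continuity_2d_pt (fun s t => sqrt (p s t ^ 2 + q s t ^ 2)) s t).
  { apply (continuity_1d_2d_pt_comp sqrt).
    - apply continuity_pt_sqrt; lra.
    - simpl; repeat first [apply continuity_2d_pt_plus | apply continuity_2d_pt_mult
        | assumption | apply continuity_2d_pt_const]. }
  assert (cl : continuity_2d_pt (fun s t => ln (y s t)) s t).
  { apply (continuity_1d_2d_pt_comp ln); [| exact cy].
    apply derivable_continuous_pt; exists (/ y s t).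
    apply derivable_pt_lim_ln; exact hy. }
  unfold energy_density_diff, Rdiv.
  assert (y s t * y s t <> 0) by nra.
  repeat first [assumption
    | apply continuity_2d_pt_plus | apply continuity_2d_pt_opp
    | apply continuity_2d_pt_mult | apply continuity_2d_pt_inv
    | apply continuity_2d_pt_const ]; lra.
Qed.

Lemma speed2_pos (a b : R) (u v : R -> R) (t : R) :
  regular_on a b u v -> a <= t <= b -> 0 < speed2 u v t.
Proof.
  intros hreg ht; unfold speed2.
  destruct (Req_dec (Derive u t) 0) as [hp | hp];
    [destruct (Req_dec (Derive v t) 0) as [hq | hq] |]; [| nra | nra].
  destruct (hreg t ht); rewrite hp, hq; reflexivity.
Qed.

(** Differentiation under the integral sign. It requires the varied height and squared speed to stay
    positive for small [s], uniformly in [t], since the logarithm, the quotient and the square root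
    are differentiated there. *)
Lemma is_derive_E_hor (lambda a b : R) (u v xi eta : R -> R) :
  a < b -> C2_on a b u -> C2_on a b v ->
  regular_on a b u v -> in_H2plus a b u v ->
  C2_on a b xi -> C2_on a b eta ->
  is_derive
    (fun s => E_hor lambda a b (fun t => u t + s * xi t)
                               (fun t => v t + s * eta t)) 0
    (RInt (fun t => energy_density_diff lambda (v t) (Derive u t) (Derive v t)
             (eta t) (Derive xi t) (Derive eta t)) a b).
Proof.
  intros hab hu hv hreg hplus hxi heta.
  assert (hmin : Rmin a b = a) by (apply Rmin_left; lra).
  assert (hmax : Rmax a b = b) by (apply Rmax_right; lra).
  set (y := fun s t => v t + s * eta t).
  set (p := fun s t => Derive u t + s * Derive xi t).
  set (q := fun s t => Derive v t + s * Derive eta t).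
  set (f := fun s t => energy_density lambda (y s t) (p s t) (q s t)).
  assert (cont0 : forall g, C2_on a b g -> forall t, a <= t <= b -> continuous g t).
  { intros g hg t ht; apply (C2_on_continuous a b g t hg ht). }
  assert (cont1 : forall g, C2_on a b g -> forall t, a <= t <= b ->
            continuous (Derive g) t).
  { intros g hg t ht; apply (C2_on_continuous a b g t hg ht). }
  assert (caff : forall (g h : R -> R) s t, continuous g t -> continuous h t ->
            continuity_2d_pt (fun s t => g t + s * h t) s t).
  { intros g h s t hg hh; apply continuity_2d_pt_plus;
      [apply continuity_2d_pt_snd; exact hg |].
    apply continuity_2d_pt_mult;
      [apply continuity_2d_pt_id1 | apply continuity_2d_pt_snd; exact hh]. }
  assert (cy : forall s t, a <= t <= b -> continuity_2d_pt y s t)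
    by (intros s t ht; apply caff; auto).
  assert (cp : forall s t, a <= t <= b -> continuity_2d_pt p s t)
    by (intros s t ht; apply caff; auto).
  assert (cq : forall s t, a <= t <= b -> continuity_2d_pt q s t)
    by (intros s t ht; apply caff; auto).
  assert (cm : forall s t, a <= t <= b ->
            continuity_2d_pt (fun s t => p s t ^ 2 + q s t ^ 2) s t).
  { intros s t ht; simpl; repeat first [solve [auto] | apply continuity_2d_pt_plus
      | apply continuity_2d_pt_mult | apply continuity_2d_pt_const]. }
  assert (hy0 : forall t, a <= t <= b -> 0 < y 0 t).
  { intros t ht; unfold y; specialize (hplus t ht); lra. }
  assert (hm0 : forall t, a <= t <= b -> 0 < p 0 t ^ 2 + q 0 t ^ 2).
  { intros t ht; unfold p, q; rewrite !Rmult_0_l, !Rplus_0_r.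
    exact (speed2_pos a b u v t hreg ht). }
  assert (hdf : forall s t, 0 < y s t -> 0 < p s t ^ 2 + q s t ^ 2 ->
            is_derive (fun z => f z t) s
              (energy_density_diff lambda (y s t) (p s t) (q s t)
                 (eta t) (Derive xi t) (Derive eta t))).
  { intros s t hy hm.
    apply (is_derive_energy_density lambda (fun z => y z t) (fun z => p z t)
             (fun z => q z t)); try assumption;
      unfold y, p, q; auto_derive; trivial; ring. }
  assert (tube := filter_and _ _
            (continuity_2d_pt_tube_pos y a b (Rlt_le _ _ hab) (cy 0) hy0)
            (continuity_2d_pt_tube_pos _ a b (Rlt_le _ _ hab) (cm 0) hm0)).
  (* [f] is affine in [s] inside each argument of the density, whereas [E_hor] contains [Derive] of
     the varied curve; the two integrands agree inside the interval, where linearity of the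
     derivative applies. *)
  apply (is_derive_ext (fun s => RInt (fun t => f s t) a b)).
  { intros s; apply RInt_ext; rewrite hmin, hmax; intros t ht.
    unfold f, y, p, q, energy_density, speed2, dist_horocycle.
    assert (hder : forall g h, C2_on a b g -> C2_on a b h ->
              Derive (fun t => g t + s * h t) t = Derive g t + s * Derive h t).
    { intros g h hg hh; apply is_derive_unique.
      apply (is_derive_plus g (fun t => s * h t)).
      - apply (C2_on_is_derive a b); [exact hg | lra].
      - apply (is_derive_scal h t s), (C2_on_is_derive a b); [exact hh | lra]. }
    rewrite !hder by assumption; reflexivity. }
  rewrite (RInt_ext _ (fun t => Derive (fun z => f z t) 0)).
  2:{ rewrite hmin, hmax; intros t ht; symmetry; apply is_derive_unique.
      assert (ht' : a <= t <= b) by lra.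
      assert (h := hdf 0 t (hy0 t ht') (hm0 t ht')).
      unfold y, p, q in h; rewrite !Rmult_0_l, !Rplus_0_r in h; exact h. }
  apply (is_derive_RInt_param f a b 0); rewrite ?hmin, ?hmax.
  - revert tube; apply filter_imp; intros s [h1 h2] t ht; eexists; apply hdf; auto.
  - intros t ht.
    apply (continuity_2d_pt_ext_loc (fun s t => energy_density_diff lambda
             (y s t) (p s t) (q s t) (eta t) (Derive xi t) (Derive eta t))).
    (* The explicit formula for the derivative in [s] is available only where height and squared
       speed are positive; continuity gives this on a full neighbourhood of [(0, t)]. *)
    + assert (h1 := continuity_2d_pt_locally_pos _ _ _ (cy 0 t ht) (hy0 t ht)).
      assert (h2 := continuity_2d_pt_locally_pos _ _ _ (cm 0 t ht) (hm0 t ht)).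
      apply (locally_2d_impl _ _ _ _ (locally_2d_forall _ _ _
        (fun s r (h : 0 < y s r /\ 0 < p s r ^ 2 + q s r ^ 2) =>
           eq_sym (is_derive_unique _ _ _ (hdf s r (proj1 h) (proj2 h)))))).
      apply locally_2d_and; assumption.
    + apply (continuity_2d_pt_energy_density_diff lambda y p q
               (fun _ t => eta t) (fun _ t => Derive xi t) (fun _ t => Derive eta t));
        auto; apply continuity_2d_pt_snd; auto.
  - revert tube; apply filter_imp; intros s [h1 h2].
    apply (ex_RInt_continuous (f s)); rewrite hmin, hmax; intros t ht.
    apply (is_derive_continuous _ _ (energy_density_diff lambda (y s t) (p s t) (q s t)
      (Derive v t + s * Derive eta t)
      (Derive (Derive u) t + s * Derive (Derive xi) t)
      (Derive (Derive v) t + s * Derive (Derive eta) t))).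
    assert (daff : forall g h dg dh, is_derive g t dg -> is_derive h t dh ->
              is_derive (fun t => g t + s * h t) t (dg + s * dh)).
    { intros g h dg dh hg hh; apply (is_derive_plus g (fun t => s * h t) t _ _ hg).
      apply (is_derive_scal h t s _ hh). }
    apply (is_derive_energy_density lambda (y s) (p s) (q s)); auto;
      apply daff; first [eapply C2_on_is_derive; eassumption
                        | eapply C2_on_is_derive2; eassumption].
Qed.

(** * Euler-Lagrange equations and curvature *)

(** The numerator [n] is kept general so that [n = p] and [n = q] yield the two momenta. *)
Lemma is_derive_momentum (lambda : R) (y p q n : R -> R) (t dy dp dq dn : R) :
  0 < y t -> 0 < p t ^ 2 + q t ^ 2 ->
  is_derive y t dy -> is_derive p t dp -> is_derive q t dq ->
  is_derive n t dn ->
  is_derive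
    (fun r => (ln (y r) + lambda) / y r * (n r / sqrt (p r ^ 2 + q r ^ 2))) t
    ((1 - (ln (y t) + lambda)) / (y t * y t) * dy
       * (n t / sqrt (p t ^ 2 + q t ^ 2))
     + (ln (y t) + lambda) / y t
       * (dn / sqrt (p t ^ 2 + q t ^ 2)
          - n t * (p t * dp + q t * dq) / sqrt (p t ^ 2 + q t ^ 2) ^ 3)).
Proof.
  intros hy hm dhy dhp dhq dhn.
  assert (hsq := sqrt_lt_R0 _ hm).
  auto_derive.
  - simpl in hm, hsq; repeat split; try (eexists; eassumption); lra.
  - replace (Derive (fun x => y x) t) with dy
      by (symmetry; apply is_derive_unique, dhy).
    replace (Derive (fun x => p x) t) with dp
      by (symmetry; apply is_derive_unique, dhp).
    replace (Derive (fun x => q x) t) with dq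
      by (symmetry; apply is_derive_unique, dhq).
    replace (Derive (fun x => n x) t) with dn
      by (symmetry; apply is_derive_unique, dhn).
    replace (p t * (p t * 1) + q t * (q t * 1)) with (p t ^ 2 + q t ^ 2) by ring.
    field; lra.
Qed.

(* The two Euler-Lagrange expressions of the energy are [- v' * EL_factor] and
   [u' * EL_factor]. *)
Definition EL_factor (lambda : R) (u v : R -> R) (t : R) : R :=
  (Derive u t - (ln (v t) + lambda) * kappa_h u v t * sqrt (speed2 u v t))
  / (v t * v t * sqrt (speed2 u v t)).

(** For [w = u] and [w = v] these are the conjugate momenta, the partial derivatives of the
    Lagrangian in [u'] and [v']. *)
Definition momentum (lambda : R) (u v w : R -> R) (t : R) : R :=
  (ln (v t) + lambda) / v t * (Derive w t / sqrt (speed2 u v t)).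

Section Curve.

Variables (lambda a b : R) (u v : R -> R).
Hypotheses (hab : a < b) (hu : C2_on a b u) (hv : C2_on a b v)
  (hreg : regular_on a b u v) (hplus : in_H2plus a b u v).

(** The Lagrangian does not depend on [u], so this derivative is, up to sign, the whole
    Euler-Lagrange expression for [u]. *)
Lemma is_derive_momentum_u (t : R) :
  a <= t <= b ->
  is_derive (momentum lambda u v u) t (Derive v t * EL_factor lambda u v t).
Proof.
  intros ht.
  assert (hm := speed2_pos a b u v t hreg ht).
  assert (hsq := sqrt_lt_R0 _ hm).
  assert (hsq2 := sqrt_sqrt _ (Rlt_le _ _ hm)).
  assert (hv1 := hplus t ht).
  evar_last.
  - apply (is_derive_momentum lambda v (Derive u) (Derive v) (Derive u));
      [lra | exact hm | | | | ];
      first [eapply C2_on_is_derive; eassumption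
            | eapply C2_on_is_derive2; eassumption].
  - change (Derive u t ^ 2 + Derive v t ^ 2) with (speed2 u v t).
    unfold EL_factor, kappa_h.
    set (S := sqrt (speed2 u v t)) in *; unfold speed2 in hsq2; simpl.
    set (p := Derive u t) in *; set (q := Derive v t) in *.
    set (dp := Derive (Derive u) t); set (dq := Derive (Derive v) t).
    (* This is the only place where [S * S = p ^ 2 + q ^ 2] enters; what remains is a rational
       identity with [S] as a free variable. *)
    replace (dp / S) with (dp * (p ^ 2 + q ^ 2) / S ^ 3)
      by (rewrite <- hsq2; field; lra).
    field; lra.
Qed.

Lemma is_derive_momentum_v (t : R) :
  a <= t <= b ->
  is_derive (momentum lambda u v v) t
    ((1 - (ln (v t) + lambda)) / (v t * v t) * sqrt (speed2 u v t)
     - Derive u t * EL_factor lambda u v t).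
Proof.
  intros ht.
  assert (hm := speed2_pos a b u v t hreg ht).
  assert (hsq := sqrt_lt_R0 _ hm).
  assert (hsq2 := sqrt_sqrt _ (Rlt_le _ _ hm)).
  assert (hv1 := hplus t ht).
  evar_last.
  - apply (is_derive_momentum lambda v (Derive u) (Derive v) (Derive v));
      [lra | exact hm | | | | ];
      first [eapply C2_on_is_derive; eassumption
            | eapply C2_on_is_derive2; eassumption].
  - change (Derive u t ^ 2 + Derive v t ^ 2) with (speed2 u v t).
    unfold EL_factor, kappa_h.
    set (S := sqrt (speed2 u v t)) in *; unfold speed2 in hsq2; simpl.
    set (p := Derive u t) in *; set (q := Derive v t) in *.
    set (dp := Derive (Derive u) t); set (dq := Derive (Derive v) t).
    replace (dq / S) with (dq * (p ^ 2 + q ^ 2) / S ^ 3)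
      by (rewrite <- hsq2; field; lra).
    replace ((1 - (ln (v t) + lambda)) / (v t * v t) * S)
      with ((1 - (ln (v t) + lambda)) / (v t * v t) * ((p ^ 2 + q ^ 2) / S))
      by (rewrite <- hsq2; field; lra).
    field; lra.
Qed.

Lemma continuous_EL_factor (t : R) :
  a <= t <= b -> continuous (EL_factor lambda u v) t.
Proof.
  intros ht; apply continuous_of_continuity_2d_pt_snd.
  assert (hm := speed2_pos a b u v t hreg ht).
  assert (hsq := sqrt_lt_R0 _ hm).
  assert (hv1 := hplus t ht).
  destruct (C2_on_continuous a b u t hu ht) as [cu [cu1 cu2]].
  destruct (C2_on_continuous a b v t hv ht) as [cv [cv1 cv2]].
  apply (continuity_2d_pt_snd _ 0) in cv, cu1, cu2, cv1, cv2.
  assert (cl : continuity_2d_pt (fun _ r => ln (v r)) 0 t).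
  { apply (continuity_1d_2d_pt_comp ln (fun _ r => v r)); [| exact cv].
    apply derivable_continuous_pt; exists (/ v t).
    apply derivable_pt_lim_ln; lra. }
  assert (cs : continuity_2d_pt (fun _ r => sqrt (speed2 u v r)) 0 t).
  { apply (continuity_1d_2d_pt_comp sqrt (fun _ r => speed2 u v r)).
    - apply continuity_pt_sqrt; lra.
    - unfold speed2; simpl; repeat first [assumption
        | apply continuity_2d_pt_plus | apply continuity_2d_pt_mult
        | apply continuity_2d_pt_const]. }
  assert (h3 : sqrt (speed2 u v t) ^ 3 <> 0) by (apply pow_nonzero; lra).
  assert (h2 : v t * v t * sqrt (speed2 u v t) <> 0).
  { repeat apply Rmult_integral_contrapositive_currified; lra. }
  unfold EL_factor, kappa_h, Rdiv; simpl in h3 |- *.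
  repeat first [assumption
    | apply continuity_2d_pt_plus | apply continuity_2d_pt_opp
    | apply continuity_2d_pt_mult | apply continuity_2d_pt_inv
    | apply continuity_2d_pt_const ]; lra.
Qed.

(** Integration by parts: the difference of the integrands is the derivative of [Q], the pairing of
    the momenta with the variation, and [Q] vanishes at both endpoints. *)
Lemma RInt_energy_density_diff (xi eta : R -> R) :
  C2_on a b xi -> C2_on a b eta ->
  xi a = 0 -> xi b = 0 -> eta a = 0 -> eta b = 0 ->
  RInt (fun t => energy_density_diff lambda (v t) (Derive u t) (Derive v t)
          (eta t) (Derive xi t) (Derive eta t)) a b =
  RInt (fun t => EL_factor lambda u v t
                 * (Derive u t * eta t - Derive v t * xi t)) a b.
Proof.
  intros hxi heta xia xib etaa etab.
  assert (hmin : Rmin a b = a) by (apply Rmin_left; lra).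
  assert (hmax : Rmax a b = b) by (apply Rmax_right; lra).
  set (D := fun t => energy_density_diff lambda (v t) (Derive u t) (Derive v t)
          (eta t) (Derive xi t) (Derive eta t)).
  set (N := fun t => EL_factor lambda u v t
                 * (Derive u t * eta t - Derive v t * xi t)).
  set (Q := fun t => momentum lambda u v u t * xi t
                     + momentum lambda u v v t * eta t).
  assert (cN : forall t, a <= t <= b -> continuous N t).
  { intros t ht; apply continuous_of_continuity_2d_pt_snd; unfold N.
    destruct (C2_on_continuous a b u t hu ht) as [_ [cu1 _]].
    destruct (C2_on_continuous a b v t hv ht) as [_ [cv1 _]].
    destruct (C2_on_continuous a b xi t hxi ht) as [cxi _].
    destruct (C2_on_continuous a b eta t heta ht) as [ceta _].
    assert (cEL := continuous_EL_factor t ht).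
    apply (continuity_2d_pt_snd _ 0) in cu1, cv1, cxi, ceta, cEL.
    repeat first [assumption | apply continuity_2d_pt_minus
      | apply continuity_2d_pt_mult]. }
  assert (cD : forall t, a <= t <= b -> continuous D t).
  { intros t ht; apply continuous_of_continuity_2d_pt_snd; unfold D.
    destruct (C2_on_continuous a b u t hu ht) as [_ [cu1 _]].
    destruct (C2_on_continuous a b v t hv ht) as [cv [cv1 _]].
    destruct (C2_on_continuous a b xi t hxi ht) as [_ [cxi1 _]].
    destruct (C2_on_continuous a b eta t heta ht) as [ceta [ceta1 _]].
    apply (continuity_2d_pt_energy_density_diff lambda
      (fun _ t => v t) (fun _ t => Derive u t) (fun _ t => Derive v t)
      (fun _ t => eta t) (fun _ t => Derive xi t) (fun _ t => Derive eta t));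
      try (apply continuity_2d_pt_snd; assumption).
    - specialize (hplus t ht); lra.
    - exact (speed2_pos a b u v t hreg ht). }
  assert (dQ : forall t, a <= t <= b -> is_derive Q t (minus (D t) (N t))).
  { intros t ht; evar_last.
    - apply (is_derive_plus (fun t => momentum lambda u v u t * xi t)
               (fun t => momentum lambda u v v t * eta t)).
      + exact (is_derive_mult (momentum lambda u v u) xi t _ _
                 (is_derive_momentum_u t ht)
                 (C2_on_is_derive a b xi t hxi ht) Rmult_comm).
      + exact (is_derive_mult (momentum lambda u v v) eta t _ _
                 (is_derive_momentum_v t ht)
                 (C2_on_is_derive a b eta t heta ht) Rmult_comm).
    - unfold D, N, energy_density_diff, momentum, minus, plus, opp, mult; simpl.
      change (Derive u t * (Derive u t * 1) + Derive v t * (Derive v t * 1))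
        with (speed2 u v t).
      unfold Rdiv; ring. }
  assert (I1 : is_RInt (fun t => minus (D t) (N t)) a b (minus (Q b) (Q a))).
  { apply (is_RInt_derive Q); rewrite hmin, hmax; intros t ht.
    - apply dQ; exact ht.
    - apply (continuous_minus D N); auto. }
  assert (I2 : ex_RInt N a b)
    by (apply (ex_RInt_continuous N); rewrite hmin, hmax; exact cN).
  assert (I3 : ex_RInt D a b)
    by (apply (ex_RInt_continuous D); rewrite hmin, hmax; exact cD).
  apply (is_RInt_unique (V := R_CompleteNormedModule)) in I1.
  rewrite (RInt_minus D N) in I1 by assumption.
  unfold Q in I1; rewrite xia, xib, etaa, etab in I1.
  unfold minus, plus, opp in I1; simpl in I1; lra.
Qed.

(** Varying [u] and [v] separately makes both products of [EL_factor] with [u'] and [v'] vanish; by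
    regularity one of these velocities is nonzero at each point. *)
Lemma horo_catenary_iff_EL_factor :
  horo_catenary lambda a b u v <->
  (forall t, a <= t <= b -> EL_factor lambda u v t = 0).
Proof.
  split.
  - intros hcrit.
    assert (hint : forall xi eta, C2_on a b xi -> C2_on a b eta ->
              xi a = 0 -> xi b = 0 -> eta a = 0 -> eta b = 0 ->
              RInt (fun t => EL_factor lambda u v t
                     * (Derive u t * eta t - Derive v t * xi t)) a b = 0).
    { intros xi eta hxi heta xia xib etaa etab.
      rewrite <- RInt_energy_density_diff by assumption.
      rewrite <- (is_derive_unique _ _ _
        (is_derive_E_hor lambda a b u v xi eta hab hu hv hreg hplus hxi heta)).
      apply is_derive_unique, hcrit; assumption. }
    assert (hcont : forall w, C2_on a b w -> forall t, a <= t <= b ->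
              continuous (fun t => EL_factor lambda u v t * Derive w t) t).
    { intros w hw t ht; apply (continuous_mult (EL_factor lambda u v) (Derive w)).
      - apply continuous_EL_factor; exact ht.
      - apply (C2_on_continuous a b w t hw ht). }
    assert (hp : forall t, a <= t <= b -> EL_factor lambda u v t * Derive u t = 0).
    { apply (fundamental_lemma_C2 a b _ hab (hcont u hu)).
      intros eta heta etaa etab.
      rewrite <- (hint (fun _ => 0) eta (C2_on_const a b 0) heta
                    eq_refl eq_refl etaa etab).
      apply RInt_ext; intros t _; simpl; ring. }
    assert (hq : forall t, a <= t <= b -> EL_factor lambda u v t * Derive v t = 0).
    { apply (fundamental_lemma_C2 a b _ hab (hcont v hv)).
      intros xi hxi xia xib.
      assert (xia' : - xi a = 0) by lra; assert (xib' : - xi b = 0) by lra.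
      (* The [xi] term of the first variation carries a minus sign, which has to be moved outside
         the integral. *)
      rewrite <- (Ropp_involutive (RInt _ a b)), <- Ropp_0; f_equal.
      rewrite <- (hint xi (fun _ => 0) hxi (C2_on_const a b 0)
                    xia xib eq_refl eq_refl).
      rewrite <- (RInt_opp (V := R_CompleteNormedModule)).
      - apply RInt_ext; intros t _; unfold opp; simpl; ring.
      - apply (ex_RInt_continuous (V := R_CompleteNormedModule)).
        rewrite Rmin_left, Rmax_right by lra; intros t ht.
        apply (continuous_mult (fun t => EL_factor lambda u v t * Derive v t) xi).
        + apply hcont; assumption.
        + apply (C2_on_continuous a b xi t hxi ht). }
    intros t ht.
    assert (hm := speed2_pos a b u v t hreg ht); unfold speed2 in hm.
    specialize (hp t ht); specialize (hq t ht).
    apply Rmult_integral in hp; apply Rmult_integral in hq.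
    destruct hp as [hp | hp]; [exact hp |].
    destruct hq as [hq | hq]; [exact hq |].
    rewrite hp, hq in hm; lra.
  - intros hEL xi eta hxi heta xia xib etaa etab.
    evar_last.
    + apply (is_derive_E_hor lambda a b u v xi eta); assumption.
    + rewrite RInt_energy_density_diff by assumption.
      rewrite (RInt_ext _ (fun _ => 0)).
      * rewrite RInt_const; unfold scal; simpl; unfold mult; simpl; ring.
      * rewrite Rmin_left, Rmax_right by lra; intros t ht.
        rewrite hEL by lra; apply Rmult_0_l.
Qed.

(* The square of the first momentum [P] has derivative
   [2 P v' EL_factor = 0], so [P] vanishes identically once [log v + lambda]
   has a zero; then [(log v + lambda) u' = 0], and differentiating this twice
   gives the claim. *)
Lemma degenerate_curve (t0 : R) :
  (forall t, a <= t <= b -> (ln (v t) + lambda) * EL_factor lambda u v t = 0) ->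
  a <= t0 <= b -> ln (v t0) + lambda = 0 ->
  Derive u t0 * Derive v t0 = 0 /\
  Derive (Derive u) t0 * Derive v t0 + Derive u t0 * Derive (Derive v) t0 = 0.
Proof.
  intros hEL ht0 hF0.
  set (P := momentum lambda u v u).
  assert (hP2 : forall t, a <= t <= b -> P t * P t = P a * P a).
  { apply (const_of_is_derive_zero_on a b (fun t => P t * P t)); intros t ht.
    evar_last.
    - apply (is_derive_mult P P t _ _ (is_derive_momentum_u t ht)
               (is_derive_momentum_u t ht) Rmult_comm).
    - unfold P, momentum, plus, mult; simpl; unfold Rdiv.
      (* [P] itself contains the factor [ln (v t) + lambda]; moving it onto [EL_factor] produces
         exactly the product that is assumed to vanish. *)
      transitivity (2 * (/ v t * (Derive u t * / sqrt (speed2 u v t))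
        * Derive v t * ((ln (v t) + lambda) * EL_factor lambda u v t)));
        [ring | rewrite (hEL t ht); ring]. }
  assert (hP : forall t, a <= t <= b -> P t = 0).
  { intros t ht; assert (h := hP2 t ht); rewrite <- (hP2 t0 ht0) in h.
    assert (hPt0 : P t0 = 0) by (unfold P, momentum; rewrite hF0; unfold Rdiv; ring).
    rewrite hPt0, Rmult_0_l in h; apply Rmult_integral in h; tauto. }
  assert (hFp : forall t, a <= t <= b -> (ln (v t) + lambda) * Derive u t = 0).
  { intros t ht.
    assert (hsq := sqrt_lt_R0 _ (speed2_pos a b u v t hreg ht)).
    assert (hv1 := hplus t ht).
    replace ((ln (v t) + lambda) * Derive u t)
      with (P t * (v t * sqrt (speed2 u v t)))
      by (unfold P, momentum; field; lra).
    rewrite (hP t ht); ring. }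
  assert (hpq : forall t, a <= t <= b -> Derive u t * Derive v t = 0).
  { intros t ht.
    assert (hv1 := hplus t ht).
    assert (hd : is_derive (fun t => (ln (v t) + lambda) * Derive u t) t
        (Derive v t / v t * Derive u t
         + (ln (v t) + lambda) * Derive (Derive u) t)).
    { evar_last.
      - apply (is_derive_mult (fun t => ln (v t) + lambda) (Derive u));
          [| eapply C2_on_is_derive2; eassumption | exact Rmult_comm].
        apply (is_derive_plus (fun t => ln (v t)) (fun _ => lambda));
          [| apply (is_derive_const (V := R_NormedModule))].
        apply (is_derive_comp ln v);
          [apply is_derive_Reals, derivable_pt_lim_ln; lra
          | eapply C2_on_is_derive; eassumption].
      - unfold plus, mult, scal, zero; simpl; unfold mult; simpl; unfold Rdiv; ring. }
    assert (h := is_derive_zero_of_zero_on a b _ t _ hab hFp ht hd).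
    (* Multiplying the differentiated relation by [u'] turns its [u''] term into a multiple of
       [(ln (v t) + lambda) * u'], which is zero. *)
    assert (h2 : (Derive u t * Derive v t) * Derive u t = 0).
    { replace ((Derive u t * Derive v t) * Derive u t) with
        (v t * ((Derive v t / v t * Derive u t
                 + (ln (v t) + lambda) * Derive (Derive u) t) * Derive u t
                - ((ln (v t) + lambda) * Derive u t) * Derive (Derive u) t))
        by (field; lra).
      rewrite h, (hFp t ht); ring. }
    apply Rmult_integral in h2; destruct h2 as [h2 | h2]; [exact h2 |].
    rewrite h2; ring. }
  split; [exact (hpq t0 ht0) |].
  apply (is_derive_zero_of_zero_on a b _ t0 _ hab hpq ht0).
  apply (is_derive_mult (Derive u) (Derive v));
    [| | exact Rmult_comm]; eapply C2_on_is_derive2; eassumption.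
Qed.

(** A division-free form of the curvature relation, which keeps its meaning at the zeros of
    [ln (v t) + lambda]. *)
Lemma EL_factor_eq_0 (t : R) :
  a <= t <= b ->
  (EL_factor lambda u v t = 0 <->
   (ln (v t) + lambda) * kappa_h u v t * sqrt (speed2 u v t) = Derive u t).
Proof.
  intros ht.
  assert (hsq := sqrt_lt_R0 _ (speed2_pos a b u v t hreg ht)).
  assert (hv1 := hplus t ht).
  assert (hd : 0 < v t * v t * sqrt (speed2 u v t))
    by (repeat apply Rmult_lt_0_compat; lra).
  unfold EL_factor; split; intros h.
  - unfold Rdiv in h; apply Rmult_integral in h; destruct h as [h | h]; [lra |].
    apply Rinv_neq_0_compat in h; [easy | lra].
  - rewrite h; unfold Rdiv; ring.
Qed.

(** Away from the zeros of [ln (v t) + lambda] this is algebra. At such a zero the left side says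
    [u' = 0] and the right side says [kappa_h = 0]; [degenerate_curve] links the two. *)
Lemma EL_factor_iff_kappa_h :
  (forall t, a <= t <= b -> EL_factor lambda u v t = 0) <->
  (forall t, a <= t <= b ->
     kappa_h u v t =
       Derive u t
         / ((dist_horocycle (v t) + lambda) * sqrt (speed2 u v t))).
Proof.
  unfold dist_horocycle; split; intros h t ht;
    assert (hm := speed2_pos a b u v t hreg ht);
    assert (hsq := sqrt_lt_R0 _ hm); assert (hv1 := hplus t ht);
    destruct (Req_dec (ln (v t) + lambda) 0) as [hF | hF].
  (* Here [u' = 0], so [v'] is nonzero by regularity and [degenerate_curve] gives [u'' = 0]; both
     terms of [kappa_h] then vanish. *)
  - assert (hp := proj1 (EL_factor_eq_0 t ht) (h t ht)).
    rewrite hF, !Rmult_0_l in hp; rewrite hF, <- hp.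
    destruct (degenerate_curve t) as [_ hdq]; [| exact ht | exact hF |].
    { intros s hs; rewrite (h s hs); ring. }
    unfold speed2 in hm; rewrite <- hp in hdq, hm.
    assert (hq : Derive v t <> 0) by (intros hq; rewrite hq in hm; lra).
    assert (hdp : Derive (Derive u) t = 0).
    { rewrite Rmult_0_l, Rplus_0_r in hdq.
      apply Rmult_integral in hdq; tauto. }
    unfold kappa_h; rewrite <- hp, hdp; unfold Rdiv; ring.
  - assert (hp := proj1 (EL_factor_eq_0 t ht) (h t ht)).
    rewrite <- hp; field; lra.
  - apply (EL_factor_eq_0 t ht); rewrite hF, !Rmult_0_l.
    assert (hk := h t ht); rewrite hF, Rmult_0_l in hk.
    unfold Rdiv in hk; rewrite Rinv_0, Rmult_0_r in hk.
    destruct (degenerate_curve t) as [hpq hdq]; [| exact ht | exact hF |].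
    (* At zeros of [ln (v s) + lambda] the product vanishes trivially, so the curvature relation is
       used only where its denominator is nonzero. *)
    { intros s hs.
      destruct (Req_dec (ln (v s) + lambda) 0) as [hFs | hFs];
        [rewrite hFs; ring |].
      rewrite (proj2 (EL_factor_eq_0 s hs)); [ring |].
      assert (hsqs := sqrt_lt_R0 _ (speed2_pos a b u v s hreg hs)).
      rewrite (h s hs); field; lra. }
    (* If [u'] were nonzero, then [v' = 0] and [v'' = 0], so [kappa_h] would reduce to
       [u' / sqrt m], contradicting [kappa_h = 0]. *)
    destruct (Req_dec (Derive u t) 0) as [hp | hp]; [easy | exfalso].
    apply Rmult_integral in hpq; destruct hpq as [hq | hq]; [easy |].
    rewrite hq, Rmult_0_r, Rplus_0_l in hdq.
    apply Rmult_integral in hdq; destruct hdq as [hdq | hdq]; [easy |].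
    unfold kappa_h in hk; rewrite hdq, hq in hk; apply hp.
    replace (Derive u t) with (Derive u t / sqrt (speed2 u v t)
      * sqrt (speed2 u v t)) by (field; lra).
    replace (Derive u t / sqrt (speed2 u v t)) with 0; [ring |].
    rewrite <- hk; unfold Rdiv; ring.
  - apply (EL_factor_eq_0 t ht); rewrite (h t ht); field; lra.
Qed.

End Curve.

(* At a point where [d_b + lambda = 0] the quotient below is [0], since
   [/ 0 = 0] in [R]; the relation then reads [kappa_h = 0]. No non-vanishing
   hypothesis is needed: vertical lines crossing the height [exp (- lambda)]
   are covered by the equivalence too. *)
Theorem theorem3p11 (lambda a b : R) (u v : R -> R)
    (hab : a < b)
    (hu : C2_on a b u) (hv : C2_on a b v)
    (hreg : regular_on a b u v)
    (hplus : in_H2plus a b u v) :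
  horo_catenary lambda a b u v <->
  (forall t, a <= t <= b ->
     kappa_h u v t =
       Derive u t
         / ((dist_horocycle (v t) + lambda) * sqrt (speed2 u v t))).
Proof.
  rewrite (horo_catenary_iff_EL_factor lambda a b u v hab hu hv hreg hplus).
  exact (EL_factor_iff_kappa_h lambda a b u v hab hu hv hreg hplus).
Qed.
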